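(* Let $\alpha>0$. There is a constant $C>0$, depending only on $\alpha$, such that for every integer $N\ge 1$ and every $u_N\in\mathbb{F}_N^{-\alpha,-\alpha}(\Lambda)$, $$|u_N|_{\alpha,*}^2\ \le\ C\,N^{4\alpha}\,\|u_N\|^2 .$$
   Context: $\Lambda=(-1,1)$; $\|\cdot\|$ is the $L^2(\Lambda)$ norm. For a function $v$ on $\Lambda$, $\tilde v$ denotes its extension by zero to $\mathbb{R}$ and $\widehat{w}(\xi)=\int_{\mathbb{R}}w(x)e^{-\mathrm{i}\xi x}\,dx$. The energy seminorm is $|v|_{\alpha,*}=\big(\frac1{2\pi}\int_{\mathbb{R}}|\xi|^{2\alpha}|\widehat{\tilde v}(\xi)|^2\,d\xi\big)^{1/2}$ (written $\|D^{\alpha}v\|$ in terms of the Riesz fractional derivative $D^\alpha$). $\mathbb{F}_N^{-\alpha,-\alpha}(\Lambda)=\{(1-x^2)^{\alpha}p(x): p \text{ a polynomial of degree}\le N\}$, i.e. the span of $\mathcal{J}_n^{-\alpha,-\alpha}(x)=(1-x^2)^{\alpha}P_n^{\alpha,\alpha}(x)$, $0\le n\le N$, where $P_n^{\alpha,\alpha}$ are the classical Jacobi polynomials. *)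

(* Defs.v *)
From HB Require Import structures.
From mathcomp Require Import all_boot all_order all_algebra.
From mathcomp Require Import complex.
From mathcomp Require Import all_classical all_reals all_analysis.

Set Implicit Arguments.
Unset Strict Implicit.
Unset Printing Implicit Defensive.

Import Order.TTheory GRing.Theory Num.Theory.

Local Open Scope classical_set_scope.
Local Open Scope ring_scope.

(* A function on Lambda is encoded as a function R -> R whose values outside
   Lambda are irrelevant: the norms look at its extension by zero, and FN only
   constrains its values on Lambda. *)
Definition Lambda {R : realType} : set R := `]-1, 1[%classic.

Definition ext0 {R : realType} (v : R -> R) : R -> R :=
  patch (fun=> 0) Lambda v.

Definition L2norm {R : realType} (v : R -> R) : \bar R :=
  ('N[lebesgue_measure]_2%:E [EFin \o ext0 v])%E.

Definition expi {R : realType} (t : R) : R[i] := (cos t +i* sin t)%C.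

(* Componentwise Lebesgue integral; as for Rintegral, the value is meaningful
   when both components are integrable. *)
Definition Cintegral {R : realType} (f : R -> R[i]) : R[i] :=
  ((\int[lebesgue_measure]_x complex.Re (f x))
   +i* (\int[lebesgue_measure]_x complex.Im (f x)))%C.

Definition fourier {R : realType} (w : R -> R) (xi : R) : R[i] :=
  Cintegral (fun x => (w x)%:C%C * expi (- (xi * x))).

(* The value is an extended real: +oo when the integral diverges. *)
Definition energy_seminorm {R : realType} (alpha : R) (v : R -> R) : \bar R :=
  (((2 * pi)^-1%:E *
    \int[lebesgue_measure]_xi
      (`|xi| `^ (2 * alpha) *
       ComplexField.Normc.normc (fourier (ext0 v) xi) ^+ 2)%:E)
   `^ 2^-1)%E.

(* size p <= N.+1 means deg p <= N, the zero polynomial included. *)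
Definition FN {R : realType} (alpha : R) (N : nat) : set (R -> R) :=
  [set u | exists2 p : {poly R}, (size p <= N.+1)%N &
     forall x, Lambda x -> u x = (1 - x ^+ 2) `^ alpha * p.[x]].

(* Main.v *)
Require Import Defs.
From HB Require Import structures.
From mathcomp Require Import all_boot all_order all_algebra.
From mathcomp Require Import complex.
From mathcomp Require Import all_classical all_reals all_analysis.
From mathcomp Require Import measurable_realfun ring lra.

(* On [-1, 1] write [w = (1 - x ^ 2) ^ alpha p] with [deg p <= N], and split the
   frequencies at [A ~ N ^ 2].  For [|xi| <= A] the weight is at most
   [A ^ (2 alpha) ~ N ^ (4 alpha)], and Bessel's inequality for exponentials on
   [-pi, pi], averaged over translates of the frequencies, bounds the remaining
   integral by [||w|| ^ 2].  For [|xi| > A], repeated integration by parts gives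
   [|w^(xi)| <= C |xi| ^ (- alpha - 1) sup |p|]: every derivative of [p] costs a
   factor [N ^ 2] by Markov's inequality, which the gain [1 / |xi|] absorbs.  The
   high-frequency energy is then at most [C (sup |p|) ^ 2 / A], and Markov's
   inequality also yields [(sup |p|) ^ 2 <= C N ^ (4 alpha + 2) ||w|| ^ 2]. *)

Set Implicit Arguments.
Unset Strict Implicit.
Unset Printing Implicit Defensive.

Import Order.TTheory GRing.Theory Num.Theory.
Import numFieldNormedType.Exports.

Local Open Scope classical_set_scope.
Local Open Scope ring_scope.

(** * Markov's inequality *)

(** For non-integer [alpha] the successive derivatives of the weight stop being integrable at the
    endpoints, so integration by parts on all of [-1, 1] breaks down. The integral is therefore cut
    at distance [d = 1 / |xi|] from -1 and 1. An edge has length [d] and weight at most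
    [(2 d) ^ alpha], which already gives [d ^ (alpha + 1)]. In the middle, an integration by parts
    gains [d] and lowers the exponent of the weight by one, worth [1 / d] at the cut; the balance is
    kept until the exponent is below -1, where absolute values suffice. Each such step also
    multiplies the polynomial by [x], so [k] steps reach degree [N + k]: hence the threshold
    [A = 4 (N + k) ^ 2], with [k] depending on [alpha] alone. Passing from the L2 norm to [sup |p|]
    costs an extra [N ^ 2] in the squares, which the tail integral of [xi ^ -2] beyond [A], equal to
    [1 / A], gives back. At low frequencies Bessel stands in for Plancherel, since its bound does
    not depend on how many frequencies are summed. *)

Section Chebyshev.
Variable R : realType.

Fixpoint cheb (n : nat) : {poly R} :=
  match n with
  | 0 => 1
  | 1 => 'X
  | (n'.+1 as m).+1 => 2%:P * 'X * cheb m - cheb n'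
  end.

Lemma chebSS n : cheb n.+2 = 2%:P * 'X * cheb n.+1 - cheb n.
Proof. by []. Qed.

Lemma nat_ind2 (P : nat -> Prop) :
  P 0 -> P 1 -> (forall n, P n -> P n.+1 -> P n.+2) -> forall n, P n.
Proof.
move=> P0 P1 PSS n; suff: P n /\ P n.+1 by case.
by elim: n => [|n [Pn Pn1]]; split=> //; apply: PSS.
Qed.

Lemma size_cheb n : (size (cheb n) <= n.+1)%N.
Proof.
elim/nat_ind2: n => [||n s0 s1]; rewrite ?size_poly1 ?size_polyX// chebSS.
rewrite (leq_trans (size_polyD _ _))// size_polyN geq_max.
rewrite (leq_trans s0 (leq_trans (leqnSn _) (leqnSn _))) andbT.
rewrite -mulrA mul_polyC (leq_trans (size_scale_leq _ _))//.
by rewrite (leq_trans (size_polyMleq _ _))// size_polyX.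
Qed.

Lemma cheb_cos n t : (cheb n).[cos t] = cos (n%:R * t).
Proof.
elim/nat_ind2: n => [||n h0 h1].
  by rewrite mul0r cos0 /= hornerE.
  by rewrite mul1r /= hornerX.
rewrite chebSS.
rewrite !hornerE h0 h1.
have -> : n.+2%:R * t = n.+1%:R * t + t by rewrite -[in LHS]natr1 mulrDl mul1r.
have -> : n%:R * t = n.+1%:R * t - t by rewrite -natr1 mulrDl mul1r addrK.
by rewrite cosB cosD; ring.
Qed.

Lemma cheb1 n : (cheb n).[1] = 1.
Proof. by rewrite -cos0 cheb_cos mulr0. Qed.

(** Differentiating the recurrence at 1 leaves [(n + 2) ^ 2 = 2 + 2 (n + 1) ^ 2 - n ^ 2]. This value
    is the source of the factor [N ^ 2] in Markov's inequality. *)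
Lemma deriv_cheb1 n : (cheb n)^`().[1] = n%:R ^+ 2.
Proof.
elim/nat_ind2: n => [||n h0 h1].
  by rewrite /= derivC !hornerE expr0n.
  by rewrite /= derivX hornerE expr1n.
rewrite chebSS derivB !derivM derivC derivX !hornerE h0 h1 cheb1.
have -> : n.+2%:R = n%:R + 2 :> R by rewrite -natrD addn2.
have -> : n.+1%:R = n%:R + 1 :> R by rewrite natr1.
ring.
Qed.

(** To the right of all roots every factor is nonnegative, and the product rule only adds products
    of such factors. *)
Lemma deriv_prod_XsubC_ge0 (s : seq R) a : (forall r, r \in s -> r <= a) ->
  0 <= (\prod_(r <- s) ('X - r%:P)).[a] /\
  0 <= (\prod_(r <- s) ('X - r%:P))^`().[a].
Proof.
elim: s => [|r s IH] h; first by rewrite big_nil derivC !hornerE ler01.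
have [|i1 i2] := IH; first by move=> x xs; apply: h; rewrite inE xs orbT.
have ra : 0 <= a - r by rewrite subr_ge0 h// mem_head.
by rewrite big_cons derivM derivB derivX derivC !hornerE; split;
  rewrite ?addr_ge0// mulr_ge0.
Qed.

(* [M T_N - p] alternates in sign at the Chebyshev extrema, so all its roots are
   real and lie in [-1, 1]; hence its derivative at 1 is nonnegative. *)
Lemma markov_endpoint N (p : {poly R}) (M : R) : (size p <= N.+1)%N ->
  (forall x : R, -1 <= x <= 1 -> `|p.[x]| < M) -> p^`().[1] <= N%:R ^+ 2 * M.
Proof.
move=> sp pM.
have M0 : 0 < M by apply: le_lt_trans (pM 0 _); rewrite // lerN10 ler01.
pose g := M *: cheb N - p.
(* The extrema of [cheb N], where it equals [(-1) ^ k]; they decrease from 1 to -1. For [N = 0] the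
   division by zero makes them all equal to 1. *)
pose x k : R := cos (k%:R / N%:R * pi).
have x1 k : -1 <= x k <= 1 by rewrite cos_geN1 cos_le1.
have gx k : (k <= N)%N -> (0 < N)%N -> 0 < (-1) ^+ k * g.[x k].
  move=> kN N0; have -> : g.[x k] = M * (-1) ^+ k - p.[x k].
    rewrite !hornerE cheb_cos; congr (M * _ - _).
    rewrite mulrA mulrCA divff ?mulr1 ?pnatr_eq0 -?lt0n//.
    elim: {kN} k => [|k IH]; first by rewrite mul0r cos0.
    by rewrite -natr1 mulrDl mul1r cosDpi IH exprS mulN1r.
  have := pM _ (x1 k); rewrite ltr_norml => /andP[p1 p2].
  rewrite mulrBr mulrCA -expr2 -exprM mulnC exprM sqrrN !expr1n mulr1.
  rewrite -signr_odd; case: (odd k); rewrite ?expr0 ?expr1 ?mulN1r ?mul1r; lra.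
have xd j k : (j <= k <= N)%N -> x k <= x j.
  case: N @g @x {sp x1 gx} => [|N] g x /andP[jk kN].
    by move: jk kN; rewrite !leqn0 => + /eqP k0; rewrite k0 leqn0 => /eqP ->.
  rewrite le_eqVlt /x; move: jk; rewrite leq_eqVlt => /predU1P[->|jk].
    by rewrite eqxx.
  have I i : (i <= N.+1)%N -> i%:R / N.+1%:R * pi \in `[0 : R, pi].
    move=> iN; rewrite in_itv/= mulr_ge0 ?pi_ge0//=.
    by rewrite ler_piMl ?pi_ge0// ler_pdivrMr// mul1r ler_nat.
  rewrite ltr_cos ?I// ?(leq_trans (ltnW jk))//.
  by rewrite ltr_pM2r ?pi_gt0// ltr_pM2r// ltr_nat jk orbT.
(* Intermediate values give a root strictly between consecutive extrema; 0 is a dummy value for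
   [k >= N]. *)
have /boolp.choice[r rP] k : exists r, (k < N)%N -> x k.+1 < r < x k /\ root g r.
  have [kN|kN] := boolP (k < N)%N; last by exists 0.
  have N0 : (0 < N)%N by apply: leq_ltn_trans kN.
  have lexx : x k.+1 <= x k by rewrite xd// leqnSn.
  have [|r rx rr] := @polyrcf.poly_ivtoo _ g _ _ lexx.
    have := mulr_gt0 (gx k (ltnW kN) N0) (gx _ kN N0).
    by rewrite exprS -signr_odd; case: (odd k); rewrite ?expr0 ?expr1; nra.
  by exists r.
pose s := [seq r k | k <- iota 0 N].
have us : uniq s.
  rewrite map_inj_in_uniq ?iota_uniq// => i j; rewrite !mem_iota/= add0n => iN jN.
  have {}rP k l : (k < l < N)%N -> r l < r k.
    move=> /andP[kl lN]; have [/andP[_ a1] _] := rP _ lN.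
    have [/andP[a2 _] _] := rP _ (ltn_trans kl lN).
    by rewrite (lt_trans a1)// (le_lt_trans _ a2)// xd// kl ltnW.
  move=> rij; apply/eqP; case: ltngtP => // ij.
    by have := @rP i j; rewrite ij jN rij ltxx => /(_ isT).
  by have := @rP j i; rewrite ij iN rij ltxx => /(_ isT).
have rs : all (root g) s.
  by apply/allP => y /mapP[k]; rewrite mem_iota/= => kN ->; case: (rP k kN).
have g1 : 0 < g.[1].
  rewrite !hornerE cheb1 mulr1 subr_gt0.
  by apply: le_lt_trans (pM 1 _); [exact: ler_norm|apply/andP; split; lra].
have g0 : g != 0 by apply: contraTneq g1 => ->; rewrite horner0 ltxx.
(* The [N] distinct roots exhaust the degree, so [g] is its leading coefficient times the product
   over [s]. *)
have sg : size g = (size s).+1.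
  apply/eqP; rewrite eqn_leq max_poly_roots// andbT size_map size_iota.
  rewrite (leq_trans (size_polyD _ _))// size_polyN geq_max sp andbT.
  by rewrite (leq_trans (size_scale_leq _ _))// size_cheb.
have gE := all_roots_prod_XsubC sg rs _; rewrite uniq_rootsE in gE.
move: (gE us); set P := \prod_(z <- s) _ => {}gE.
have [|P1 P2] := @deriv_prod_XsubC_ge0 s 1.
  move=> y /mapP[k]; rewrite mem_iota/= => kN ->.
  have [/andP[_ /ltW a1] _] := rP k kN; apply: le_trans a1 _.
  by case/andP: (x1 k).
have lg : 0 <= lead_coef g.
  rewrite leNgt; apply: contraTN g1 => l0.
  by rewrite gE hornerZ -leNgt nmulr_rle0.
have : 0 <= g^`().[1] by rewrite gE derivZ hornerZ mulr_ge0.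
by rewrite /g derivB derivZ !hornerE deriv_cheb1 subr_ge0 mulrC.
Qed.

(* At [x >= 0], rescale [-1, x] to [-1, 1] and use the endpoint bound. *)
Lemma markov N (p : {poly R}) (M : R) : (size p <= N.+1)%N ->
  (forall x : R, -1 <= x <= 1 -> `|p.[x]| <= M) ->
  forall x : R, -1 <= x <= 1 -> `|p^`().[x]| <= 2 * N%:R ^+ 2 * M.
Proof.
have half (q : {poly R}) (L x : R) : (size q <= N.+1)%N ->
    (forall x : R, -1 <= x <= 1 -> `|q.[x]| < L) -> 0 <= x <= 1 ->
    q^`().[x] <= 2 * N%:R ^+ 2 * L.
  move=> sq qL /andP[x0 x1].
  have L0 : 0 < L by apply: le_lt_trans (qL 0 _); rewrite // lerN10 ler01.
  (* [l] fixes -1 and sends 1 to [x]. Its slope [a] is at least 1/2 because [x >= 0], which is where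
     the factor 2 comes from. *)
  pose a := (x + 1) / 2; pose l := a *: 'X + (x - a)%:P.
  have a0 : 2^-1 <= a by rewrite /a; lra.
  have sl : (size l <= 2)%N.
    rewrite (leq_trans (size_polyD _ _))// geq_max.
    rewrite (leq_trans (size_scale_leq _ _)) ?size_polyX//=.
    by rewrite (leq_trans (size_polyC_leq1 _)).
  have lE z : l.[z] = a * (z - 1) + x by rewrite !hornerE/=; ring.
  have l'E : l^`() = a%:P.
    by rewrite /l derivD derivZ derivX derivC addr0 alg_polyC.
  have : (q \Po l)^`().[1] <= N%:R ^+ 2 * L.
    apply: markov_endpoint => [|y y1].
      have [->|q0] := eqVneq q 0; first by rewrite comp_poly0 size_poly0.
      rewrite (leq_trans (size_comp_poly_leq _ _))// ltnS.
      have sl1 : ((size l).-1 <= 1)%N by case: (size l) sl.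
      rewrite (leq_trans (leq_mul (leqnn _) sl1))// muln1.
      by rewrite -ltnS prednK// size_poly_gt0.
    rewrite horner_comp qL// lE /a.
    by move/andP: y1 => [y0 y1]; apply/andP; split; nra.
  rewrite deriv_comp hornerM horner_comp lE l'E hornerC subrr mulr0 add0r => h.
  have NL : 0 <= N%:R ^+ 2 * L by rewrite mulr_ge0 ?exprn_ge0// ltW.
  have [q0|q0] := leP 0 (q^`().[x]).
    have : q^`().[x] * 2^-1 <= N%:R ^+ 2 * L.
      by rewrite (le_trans _ h)// ler_wpM2l.
    by rewrite ler_pdivrMr// mulrC mulrA.
  by rewrite (le_trans (ltW q0))// -mulrA mulr_ge0.
have sym (q : {poly R}) (L x : R) : (size q <= N.+1)%N ->
    (forall x : R, -1 <= x <= 1 -> `|q.[x]| < L) -> 0 <= x <= 1 ->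
    `|q^`().[x]| <= 2 * N%:R ^+ 2 * L.
  move=> sq qL x01; rewrite ler_norml lerNl -hornerN -derivN !half ?size_polyN//.
  by move=> y y1; rewrite hornerN normrN qL.
move=> sp pM x xI; apply/ler_addgt0Pr => e e0.
have cN : 0 < 2 * N%:R ^+ 2 + 1 :> R by rewrite ltr_wpDl// mulr_ge0// exprn_ge0.
(* The endpoint bound wants a strict majorant of [|p|]; this one raises the final bound by at most
   [e]. *)
pose L := M + e / (2 * N%:R ^+ 2 + 1).
have pL y : -1 <= y <= 1 -> `|p.[y]| < L.
  by move=> /pM pyM; rewrite (le_lt_trans pyM)// ltrDl divr_gt0.
have leL : 2 * N%:R ^+ 2 * L <= 2 * N%:R ^+ 2 * M + e.
  rewrite /L mulrDr lerD2l mulrCA ler_piMr ?(ltW e0)// ler_pdivrMr// mul1r.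
  by rewrite lerDl ler01.
apply: le_trans leL; have [x0|x0] := leP 0 x.
  by apply: sym => //; rewrite x0; case/andP: xI.
(* Negative [x] reduces to the previous case by the reflection [x -> - x]. *)
have pcN y : (p \Po - 'X).[y] = p.[- y] by rewrite horner_comp !hornerE.
have -> : `|p^`().[x]| = `|(p \Po - 'X)^`().[- x]|.
  rewrite deriv_comp derivN derivX hornerM horner_comp !hornerN hornerX hornerC.
  by rewrite opprK normrM normrN normr1 mulr1.
apply: sym; first by rewrite size_comp_poly2// size_polyN size_polyX.
  by move=> y /andP[y1 y2]; rewrite pcN pL// lerN2 y2 lerNl.
by move/andP: xI x0 => [] *; apply/andP; split; lra.
Qed.

End Chebyshev.

(** * Decay of oscillatory integrals *)

Section OneDimensionalCalculus.
Variable R : realType.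
Local Notation mu := (@lebesgue_measure R).

Lemma integrable_itvcc (f : R -> R) (a b : R) :
  (forall x, a <= x <= b -> {for x, continuous f}) ->
  mu.-integrable `[a, b] (EFin \o f).
Proof.
move=> cf; apply: continuous_compact_integrable; first exact: segment_compact.
by apply: continuous_in_subspaceT => x; rewrite inE/= in_itv/= => /cf.
Qed.

Lemma Rintegral_FTC2 (f F : R -> R) (a b : R) : a < b ->
  (forall x, a <= x <= b -> is_derive x (1 : R) F (f x)) ->
  (forall x, a <= x <= b -> {for x, continuous f}) ->
  \int[mu]_(x in `[a, b]) f x = F b - F a.
Proof.
move=> ab Ff cf; rewrite /Rintegral (@continuous_FTC2 _ f F)//.
- by apply: continuous_in_subspaceT => x; rewrite inE/= in_itv/= => /cf.
- have cF x : a <= x <= b -> {for x, continuous F}.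
    move=> /Ff [dF _].
    by apply/differentiable_continuous/derivable1_diffP.
  split.
  + by move=> x; rewrite in_itv/= => /andP[/ltW ax /ltW xb]; case: (Ff x); rewrite ?ax.
  + by apply: cvg_at_right_filter; apply: cF; rewrite lexx ltW.
  + by apply: cvg_at_left_filter; apply: cF; rewrite lexx ltW.
- move=> x; rewrite in_itv/= => /andP[/ltW ax /ltW xb].
  by case: (Ff x); rewrite ?ax// => _ <-; rewrite derive1E.
Qed.

Lemma le_normr_Rintegral_itvcc (f g : R -> R) (a b : R) :
  (forall x, a <= x <= b -> {for x, continuous f}) ->
  (forall x, a <= x <= b -> {for x, continuous g}) ->
  (forall x, a <= x <= b -> `|f x| <= g x) ->
  `|\int[mu]_(x in `[a, b]) f x| <= \int[mu]_(x in `[a, b]) g x.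
Proof.
move=> cf cg fg.
apply: le_trans (le_normr_Rintegral _ (integrable_itvcc cf)) _ => //.
apply: le_Rintegral => //; last exact: integrable_itvcc.
  by apply: integrable_itvcc => x /cf; exact: cvg_norm.
Qed.

Lemma is_derive_continuous (f : R -> R) (x df : R) :
  is_derive x (1 : R) f df -> {for x, continuous f}.
Proof. by case=> df' _; apply/differentiable_continuous/derivable1_diffP. Qed.

End OneDimensionalCalculus.

(** * Integration by parts against an oscillating phase, away from the endpoints *)

Section OscillatoryIntegral.
Variable R : realType.
Local Notation mu := (@lebesgue_measure R).
Implicit Types (b d M xi phi x : R) (p : {poly R}).

(** The free phase [phi] covers cosine and sine at once and keeps the family closed under
    integration by parts. The exponent [b] may be negative. *)
Definition osc b p xi phi (x : R) := (1 - x ^+ 2) `^ b * p.[x] * cos (xi * x + phi).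

Lemma is_derive_comp1 (f g : R -> R) x (df dg : R) :
  is_derive x (1 : R) f df -> is_derive (f x) (1 : R) g dg ->
  is_derive x (1 : R) (g \o f) (dg * df).
Proof. by move=> hf hg; exact: is_derive1_comp. Qed.

Lemma is_derive_weight b x : -1 < x < 1 ->
  is_derive x (1 : R) (fun x => (1 - x ^+ 2) `^ b)
    (- 2 * b * x * (1 - x ^+ 2) `^ (b - 1)).
Proof.
move=> /andP[x1 x2].
have x0 : 0 < 1 - x ^+ 2 by nra.
have h1 : is_derive x (1 : R) (fun x : R => 1 - x ^+ 2) (- (2 * x)).
  by apply: is_derive_eq; rewrite /GRing.scale/=; ring.
have := is_derive_comp1 h1 (is_derive1_powR b x0).
move/is_derive_eq; apply; ring.
Qed.

Lemma is_derive_phase_cos xi phi x :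
  is_derive x (1 : R) (fun x => cos (xi * x + phi)) (- xi * sin (xi * x + phi)).
Proof.
have h1 : is_derive x (1 : R) (fun x : R => xi * x + phi) xi.
  by apply: is_derive_eq; rewrite /GRing.scale/=; ring.
have := is_derive_comp1 h1 (is_derive_cos _).
move/is_derive_eq; apply; ring.
Qed.

Lemma is_derive_phase_sin xi phi x :
  is_derive x (1 : R) (fun x => sin (xi * x + phi)) (xi * cos (xi * x + phi)).
Proof.
have h1 : is_derive x (1 : R) (fun x : R => xi * x + phi) xi.
  by apply: is_derive_eq; rewrite /GRing.scale/=; ring.
have := is_derive_comp1 h1 (is_derive_sin _).
move/is_derive_eq; apply; ring.
Qed.

Lemma is_derive_mul (f g : R -> R) (x df dg : R) :
  is_derive x (1 : R) f df -> is_derive x (1 : R) g dg ->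
  is_derive x (1 : R) (fun x => f x * g x) (f x * dg + g x * df).
Proof. by move=> hf hg; exact: is_deriveM. Qed.

Lemma continuous_osc b p xi phi x : -1 < x < 1 -> {for x, continuous (osc b p xi phi)}.
Proof.
move=> x1; apply: is_derive_continuous; apply: is_derive_mul.
  by apply: is_derive_mul; exact: is_derive_weight.
Qed.

Local Notation int_osc b p xi phi d := (\int[mu]_(x in `[-1 + d, 1 - d]) osc b p xi phi x).

Lemma le0_ger_powR b (s t : R) : b <= 0 -> 0 < s <= t -> t `^ b <= s `^ b.
Proof.
move=> b0 /andP[s0 st]; have t0 := lt_le_trans s0 st.
rewrite -[b]opprK !(powRN _ (- b)) lef_pV2 ?posrE ?powR_gt0//.
by rewrite ge0_ler_powR ?nnegrE ?oppr_ge0// ltW.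
Qed.

(** No oscillation is used. As [b] is negative and [1 - x ^ 2 = (1 - x) (1 + x)], the weight is at
    most [(1 - x) ^ b] for [x >= 0] and [(1 + x) ^ b] for [x < 0]; [G] is an explicit primitive of
    the sum of both, times [M]. *)
Lemma norm_int_osc_base b p M xi phi d : b < -1 -> 0 < d < 1 ->
  (forall x, -1 <= x <= 1 -> `|p.[x]| <= M) ->
  `|int_osc b p xi phi d| <= - 2 / (b + 1) * d `^ (b + 1) * M.
Proof.
move=> b1 /andP[d0 d1] pM.
have M0 : 0 <= M by apply: le_trans (pM 0 _) => //; apply/andP; split; lra.
have b10 : b + 1 != 0 by rewrite lt_eqF//; lra.
pose g x := M * (1 - x) `^ b + M * (1 + x) `^ b.
pose G x := M / (b + 1) * (1 + x) `^ (b + 1) - M / (b + 1) * (1 - x) `^ (b + 1).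
have pow_mx (c x : R) : x < 1 ->
    is_derive x (1 : R) (fun x => (1 - x) `^ c) (- (c * (1 - x) `^ (c - 1))).
  move=> x1; have x0 : 0 < 1 - x by lra.
  have h1 : is_derive x (1 : R) (fun x : R => 1 - x) (- 1).
    by apply: is_derive_eq; ring.
  by have := is_derive_comp1 h1 (is_derive1_powR c x0); move/is_derive_eq; apply; ring.
have pow_px (c x : R) : -1 < x ->
    is_derive x (1 : R) (fun x => (1 + x) `^ c) (c * (1 + x) `^ (c - 1)).
  move=> x1; have x0 : 0 < 1 + x by lra.
  have h1 : is_derive x (1 : R) (fun x : R => 1 + x) 1.
    by apply: is_derive_eq; ring.
  by have := is_derive_comp1 h1 (is_derive1_powR c x0); move/is_derive_eq; apply; ring.
have dG x : -1 < x < 1 -> is_derive x (1 : R) G (g x).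
  move=> /andP[x1 x2]; have h1 := pow_mx (b + 1) _ x2; have h2 := pow_px (b + 1) _ x1.
  rewrite /G; apply: is_derive_eq; rewrite /GRing.scale/= /g addrK; field.
  by [].
have cg x : -1 < x < 1 -> {for x, continuous g}.
  move=> /andP[x1 x2]; have h1 := pow_mx b _ x2; have h2 := pow_px b _ x1.
  by apply: is_derive_continuous; rewrite /g; apply: is_derive_eq.
have inside x : -1 + d <= x <= 1 - d -> -1 < x < 1.
  by move=> /andP[? ?]; apply/andP; split; lra.
apply: (@le_trans _ _ (\int[mu]_(x in `[-1 + d, 1 - d]) g x)).
  apply: le_normr_Rintegral_itvcc => [x /inside|x /inside|x /inside x1].
    exact: continuous_osc.
    exact: cg.
  rewrite /osc !normrM (ger0_norm (powR_ge0 _ _)).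
  apply: (@le_trans _ _ ((1 - x ^+ 2) `^ b * `|p.[x]|)).
    by rewrite ler_piMr ?mulr_ge0 ?powR_ge0// cos_max.
  rewrite mulrC /g -mulrDr ler_pM ?powR_ge0//.
    by apply: pM; case/andP: x1 => /ltW -> /ltW.
  have [x0|x0] := leP 0 x.
    rewrite (@le_trans _ _ ((1 - x) `^ b))//; last by rewrite lerDl powR_ge0.
    by apply: le0_ger_powR; [lra|case/andP: x1 => *; apply/andP; split; nra].
  rewrite (@le_trans _ _ ((1 + x) `^ b))//; last by rewrite lerDr powR_ge0.
  by apply: le0_ger_powR; [lra|case/andP: x1 => *; apply/andP; split; nra].
have -> : \int[mu]_(x in `[-1 + d, 1 - d]) g x = G (1 - d) - G (-1 + d).
  by apply: Rintegral_FTC2 => [|x /inside|x /inside]; [lra|exact: dG|exact: cg].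
rewrite /G.
have -> : 1 + (1 - d) = 2 - d by ring.
have -> : 1 - (1 - d) = d by ring.
have -> : 1 + (-1 + d) = d by ring.
have -> : 1 - (-1 + d) = 2 - d by ring.
(* This is exactly the amount by which the claimed bound exceeds the integral of [g]; its sign comes
   from [b + 1 < 0]. *)
have h : 0 <= - 2 / (b + 1) * M * (2 - d) `^ (b + 1).
  rewrite mulr_ge0 ?powR_ge0// mulr_ge0// -mulrNN -invrN mulr_ge0// ?invr_ge0; lra.
rewrite -subr_ge0; apply: le_trans h _; rewrite le_eqVlt; apply/orP; left.
by apply/eqP; field.
Qed.

(** Integrate the derivative of [B]. The sines that appear are cosines of phase [phi - pi / 2], so
    both new integrals are again of the form [int_osc]: one with [p'], the other with weight
    exponent [b - 1] and one more factor [x]. *)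
Lemma int_osc_by_parts b p xi phi d : xi != 0 -> 0 < d < 1 ->
  let B x := (1 - x ^+ 2) `^ b * p.[x] * sin (xi * x + phi) in
  int_osc b p xi phi d =
  xi^-1 * (B (1 - d) - B (-1 + d) - int_osc b p^`() xi (phi - pi / 2) d +
           2 * b * int_osc (b - 1) ('X * p) xi (phi - pi / 2) d).
Proof.
move=> xi0 /andP[d0 d1] B.
have inside x : -1 + d <= x <= 1 - d -> -1 < x < 1.
  by move=> /andP[? ?]; apply/andP; split; lra.
pose f x := xi * osc b p xi phi x + (osc b p^`() xi (phi - pi / 2) x -
             2 * b * osc (b - 1) ('X * p) xi (phi - pi / 2) x).
have co c q ph x : -1 + d <= x <= 1 - d -> {for x, continuous (osc c q xi ph)}.
  by move=> /inside; exact: continuous_osc.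
have io c q ph := integrable_itvcc (co c q ph).
have czl (k : R) (h : R -> R) x : {for x, continuous h} -> {for x, continuous (fun x => k * h x)}.
  by move=> hc; apply: cvgM => //; exact: cvg_cst.
have : \int[mu]_(x in `[-1 + d, 1 - d]) f x = B (1 - d) - B (-1 + d).
  apply: Rintegral_FTC2; first lra.
    move=> x /inside x1.
    have h1 := is_derive_weight b x1; have h2 := is_derive_phase_sin xi phi x.
    have := is_derive_mul (is_derive_mul h1 (is_derive_poly p x)) h2.
    move/is_derive_eq; apply.
    have sE : cos (xi * x + (phi - pi / 2)) = sin (xi * x + phi).
      by rewrite addrA cosBpihalf.
    rewrite /f /osc hornerM hornerX sE; ring.
  move=> x x1; apply: cvgD; first exact/czl/co.
  by apply: cvgB; [exact: co|exact/czl/co].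
have izl k c q ph :
    mu.-integrable `[-1 + d, 1 - d] (EFin \o (fun x => k * osc c q xi ph x)).
  by apply: integrable_itvcc => x x1; exact/czl/co.
rewrite /f RintegralD//; last first.
  apply: integrable_itvcc => x x1.
  by apply: cvgB; [exact: co|exact/czl/co].
rewrite RintegralB// !RintegralZl//.
set I0 := int_osc b p xi phi d; set I1 := \int[_]_(_ in _) osc _ _ _ _ _.
set I2 := \int[_]_(_ in _) osc _ _ _ _ _.
by move=> <-; field.
Qed.

(* The weight exponent drops by one at each integration by parts until the
   integral converges absolutely at scale [d]; the term with [p'] costs a factor
   [2 N ^ 2 d <= 1 / 2] by Markov, hence is absorbed by induction on the degree. *)
Lemma norm_int_osc (k : nat) b : b < k%:R - 1 ->
  exists2 C : R, 0 <= C & forall N p M xi phi d, (size p <= N.+1)%N ->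
    (forall x, -1 <= x <= 1 -> `|p.[x]| <= M) ->
    0 < d < 1 -> `|xi| * d = 1 -> 4 * (N + k)%:R ^+ 2 * d <= 1 ->
    `|int_osc b p xi phi d| <= C * d `^ (b + 1) * M.
Proof.
elim: k b => [|k IH] b bk.
  have b1 : b < -1 by rewrite sub0r in bk.
  exists (- 2 / (b + 1)).
    rewrite -mulrNN -invrN mulr_ge0// ?invr_ge0; lra.
  by move=> N p M xi phi d _ pM d01 _ _; exact: norm_int_osc_base.
have [|C' C'0 HC'] := IH (b - 1); first by move: bk; rewrite -natr1; lra.
(* Two boundary terms, then the integral with exponent [b - 1]. The final constant [2 * E] solves
   [K = E + K / 2], where [K / 2] comes from the term with the derivative. *)
pose E := 2 * 2 `^ `|b| + 2 * `|b| * C'.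
have E0 : 0 <= E by rewrite addr_ge0 ?mulr_ge0 ?powR_ge0.
exists (2 * E); first by rewrite mulr_ge0.
move=> N p M xi phi d sp pM d01 xid Nd; case/andP: (d01) => d0 d1.
have xi0 : xi != 0 by apply: contra_eq_neq xid => ->; rewrite normr0 mul0r eq_sym oner_eq0.
have xiV : `|xi^-1| = d.
  by rewrite normfV; apply: (mulfI (_ : `|xi| != 0)); rewrite ?normr_eq0// xid divff// normr_eq0.
have dpow : d * d `^ b = d `^ (b + 1).
  by rewrite powRD ?(gt_eqF d0) ?implybT// powRr1 1?mulrC// ltW.
have N2d : 2 * N%:R ^+ 2 * d <= 2^-1.
  have : N%:R ^+ 2 * d <= (N + k.+1)%:R ^+ 2 * d.
    by rewrite ler_pM2r// ler_sqr ?nnegrE// ler_nat leq_addr.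
  by move: Nd; lra.
(* The size of [q] varies in the induction while [N] stays fixed, so that the Markov factor and the
   condition on [d] do not change. *)
suff main n (q : {poly R}) (L ph : R) : (n <= N.+1)%N -> (size q <= n)%N ->
    (forall x, -1 <= x <= 1 -> `|q.[x]| <= L) ->
    `|int_osc b q xi ph d| <= 2 * E * d `^ (b + 1) * L.
  exact: main (leqnn _) sp pM.
elim: n q L ph => [|n IHn] q L ph nN sq qL.
  have L0 : 0 <= L by apply: le_trans (qL 0 _) => //; apply/andP; split; lra.
  move: sq; rewrite leqn0 size_poly_eq0 => /eqP ->.
  rewrite (_ : osc _ _ _ _ = cst 0).
    by rewrite Rintegral_cst//= mul0r normr0 !mulr_ge0 ?powR_ge0.
  by apply/funext => x; rewrite /osc horner0 mulr0 mul0r.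
have L0 : 0 <= L by apply: le_trans (qL 0 _) => //; apply/andP; split; lra.
have sqN := leq_trans sq nN.
have I1 : d * `|int_osc b q^`() xi (ph - pi / 2) d| <= E * d `^ (b + 1) * L.
  have := IHn q^`() (2 * N%:R ^+ 2 * L) (ph - pi / 2) (ltnW nN).
  have -> : (size q^`() <= n)%N.
    have [->|q0] := eqVneq q 0; first by rewrite deriv0 size_poly0.
    by rewrite -ltnS (leq_trans _ sq)// lt_size_deriv.
  move=> /(_ isT (markov sqN qL)) h.
  apply: le_trans (ler_wpM2l (ltW d0) h) _.
  have K0 : 0 <= E * d `^ (b + 1) * L by rewrite !mulr_ge0 ?powR_ge0.
  have := ler_wpM2r K0 N2d; set X := d `^ _; lra.
have I2 : `|int_osc (b - 1) ('X * q) xi (ph - pi / 2) d| <= C' * d `^ b * L.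
  have -> : d `^ b = d `^ (b - 1 + 1) by rewrite subrK.
  (* The factor ['X] raises the degree by one while the number of remaining steps falls by one:
     [N + k], hence the condition on [d], is preserved. *)
  apply: (HC' N.+1) => //; last by rewrite addSnnS.
    by rewrite (leq_trans (size_polyMleq _ _))// size_polyX.
  move=> x x1; rewrite hornerM hornerX normrM.
  have h : `|x| <= 1 by rewrite ler_norml.
  by rewrite -[L]mul1r ler_pM// qL.
(* At both cut points [1 - x ^ 2 = (2 - d) d], and [1 <= 2 - d <= 2] gives [(2 - d) ^ b <= 2 ^ |b|]
   for either sign of [b]. *)
have HB x : x ^+ 2 = (1 - d) ^+ 2 -> -1 <= x <= 1 ->
    `|(1 - x ^+ 2) `^ b * q.[x] * sin (xi * x + ph)| <= 2 `^ `|b| * d `^ b * L.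
  move=> -> x1; rewrite (_ : 1 - _ = (2 - d) * d); last by ring.
  rewrite powRM//; [|lra|lra].
  rewrite !normrM !(ger0_norm (powR_ge0 _ _)).
  apply: (@le_trans _ _ ((2 - d) `^ b * d `^ b * `|q.[x]|)).
    by rewrite ler_piMr ?mulr_ge0 ?powR_ge0// sin_max.
  rewrite ler_pM ?mulr_ge0 ?powR_ge0 ?qL// ler_pM2r ?powR_gt0//.
  apply: (@le_trans _ _ ((2 - d) `^ `|b|)); first by rewrite ler_powR ?ler_norm//; lra.
  by rewrite ge0_ler_powR// ?nnegrE; lra.
rewrite int_osc_by_parts// normrM xiV.
set B1 := _ * sin (xi * (1 - d) + _); set B2 := _ * sin (xi * (-1 + d) + _).
have hB1 : `|B1| <= 2 `^ `|b| * d `^ b * L.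
  by apply: HB => //; apply/andP; split; lra.
have hB2 : `|B2| <= 2 `^ `|b| * d `^ b * L.
  by apply: HB; [ring|apply/andP; split; lra].
move: I1 I2.
set J1 := \int[_]_(_ in _) osc b _ _ _ _; set J2 := \int[_]_(_ in _) osc _ _ _ _ _.
move=> I1 I2.
have I2' : `|2 * b * J2| <= 2 * `|b| * (C' * d `^ b * L).
  by rewrite !normrM (ger0_norm (ler0n _ 2)) ler_wpM2l// mulr_ge0.
apply: (@le_trans _ _ (d * (`|B1| + `|B2| + `|J1| + `|2 * b * J2|))).
  apply: ler_wpM2l; first exact: ltW.
  rewrite (le_trans (ler_normD _ _))// lerD2r.
  rewrite (le_trans (ler_normB _ _))// lerD2r; exact: ler_normB.
apply: (@le_trans _ _ (d * (2 `^ `|b| * d `^ b * L + 2 `^ `|b| * d `^ b * L +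
    2 * `|b| * (C' * d `^ b * L)) + d * `|J1|)).
  by rewrite -mulrDr; apply: ler_wpM2l; [exact: ltW|lra].
have -> : d * (2 `^ `|b| * d `^ b * L + 2 `^ `|b| * d `^ b * L +
    2 * `|b| * (C' * d `^ b * L)) = E * (d * d `^ b) * L by rewrite /E; ring.
by rewrite dpow; set X := d `^ _ in I1 *; lra.
Qed.

End OscillatoryIntegral.

(** * The zero extension of the weighted polynomial: Fourier decay and sup norm against L2 norm *)

Section WeightedPolynomial.
Variable R : realType.
Local Notation mu := (@lebesgue_measure R).
Implicit Types (a b d M xi phi x : R) (p : {poly R}).

(** The truncation at 0 builds in the extension by zero when [a > 0], and makes the function
    continuous on the whole line. *)
Definition wpoly a p x := Num.max 0 (1 - x ^+ 2) `^ a * p.[x].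

Lemma continuous_max0_powR a : 0 < a -> continuous (fun y : R => Num.max 0 y `^ a).
Proof.
move=> a0 y; have [y0|y0|y0] := ltgtP y 0.
- rewrite /continuous_at (max_l (ltW y0)) powR0 ?gt_eqF//.
  apply: cvg_near_cst; near=> z; rewrite max_l ?powR0 ?gt_eqF//.
  by apply/ltW; near: z; exact: lt_nbhsl.
- rewrite /continuous_at (max_r (ltW y0)).
  apply: (@cvg_trans _ ((fun z => z `^ a) @ y)).
    apply: near_eq_cvg; near=> z; rewrite max_r//.
    by apply/ltW; near: z; exact: lt_nbhsr.
  exact: is_derive_continuous (is_derive1_powR a y0).
- rewrite y0 /continuous_at maxxx powR0 ?gt_eqF//.
  apply/cvgrPdist_lt => e e0; near=> z.
  rewrite sub0r normrN ger0_norm ?powR_ge0//.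
  have -> : e = (e `^ a^-1) `^ a by rewrite -powRrM mulVf ?powRr1 ?gt_eqF// ltW.
  rewrite gt0_ltr_powR ?nnegrE ?le_max ?lexx ?powR_ge0//.
  rewrite gt_max powR_gt0//=.
  by near: z; apply: lt_nbhsl; exact: powR_gt0.
Unshelve. all: by end_near. Qed.

Lemma continuous_wpoly a p : 0 < a -> continuous (wpoly a p).
Proof.
move=> a0 x; have h : {for x, continuous (fun x : R => 1 - x ^+ 2)}.
  apply: (@is_derive_continuous _ _ _ (- (2 * x))); apply: is_derive_eq.
  by rewrite /GRing.scale/=; ring.
have h2 : {for x, continuous ((fun y : R => Num.max 0 y `^ a) \o (fun x : R => 1 - x ^+ 2))}.
  by apply: continuous_comp => //; exact: continuous_max0_powR.
exact: (cvgM h2 (is_derive_continuous (is_derive_poly p x))).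
Qed.

Lemma Rintegral_itvcc_split (f : R -> R) (l m r : R) : l <= m <= r -> continuous f ->
  \int[mu]_(x in `[l, r]) f x = \int[mu]_(x in `[l, m]) f x + \int[mu]_(x in `[m, r]) f x.
Proof.
move=> /andP[lm mr] cf.
have If (s t : R) : mu.-integrable `[s, t] (EFin \o f) by apply: integrable_itvcc => x _; exact: cf.
rewrite -(@Rintegral_itv_obnd_cbnd _ m); last first.
  by apply: integrableS (If m r) => //; exact: subset_itv_oc_cc.
by rewrite -(@Rintegral_itvB _ f (BLeft l) (BRight r) m)// addrC subrK.
Qed.

Lemma norm_Rintegral_itvcc_le (f : R -> R) (l r K : R) : l <= r -> continuous f ->
  (forall x, l <= x <= r -> `|f x| <= K) ->
  `|\int[mu]_(x in `[l, r]) f x| <= K * (r - l).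
Proof.
move=> lr cf fK.
have -> : K * (r - l) = \int[mu]_(x in `[l, r]) (cst K x).
  rewrite Rintegral_cst//= lebesgue_measure_itv/= lte_fin.
  by case: ltgtP lr => //= -> _; rewrite subrr.
by apply: le_normr_Rintegral_itvcc => // x _; [exact: cf|exact: cvg_cst].
Qed.

Lemma continuous_phase_cos (f : R -> R) xi phi : continuous f ->
  continuous (fun x => f x * cos (xi * x + phi)).
Proof.
move=> cf x; apply: cvgM; first exact: cf.
exact: is_derive_continuous (is_derive_phase_cos xi phi x).
Qed.

(** Here [1 - x ^ 2 = (1 - |x|) (1 + |x|) <= 2 d]. It serves for the two edges that [int_osc] leaves
    out. *)
Lemma wpoly_edge a p M x d : 0 < a -> 0 <= d -> 1 - d <= `|x| <= 1 ->
  (forall x, -1 <= x <= 1 -> `|p.[x]| <= M) ->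
  `|wpoly a p x| <= (2 * d) `^ a * M.
Proof.
move=> a0 d0 /andP[xd x1] pM; rewrite /wpoly normrM ger0_norm ?powR_ge0//.
rewrite ler_pM ?powR_ge0 ?pM -?ler_norml//.
rewrite ge0_ler_powR ?nnegrE ?le_max ?lexx ?(ltW a0)//; first by rewrite mulr_ge0.
rewrite ge_max mulr_ge0//=.
have : (1 - `|x|) * (1 + `|x|) <= d * 2 by rewrite ler_pM//; lra.
by rewrite -real_normK ?num_real//; lra.
Qed.

Lemma wpoly_fourier_decay a : 0 < a ->
  exists2 C : R, 0 <= C & exists k, forall N p M xi phi d, (size p <= N.+1)%N ->
    (forall x, -1 <= x <= 1 -> `|p.[x]| <= M) ->
    0 < d < 1 -> `|xi| * d = 1 -> 4 * (N + k)%:R ^+ 2 * d <= 1 ->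
    `|\int[mu]_(x in `[-1, 1]) (wpoly a p x * cos (xi * x + phi))|
      <= C * d `^ (a + 1) * M.
Proof.
(* Enough integrations by parts to bring the exponent [a - k] below -1. *)
move=> a0; pose k := (Num.truncn (a + 1)).+1.
have ak : a < k%:R - 1 by have := truncnS_gt (a + 1); rewrite /k -natr1; lra.
have [C C0 HC] := norm_int_osc ak.
exists (C + 2 * 2 `^ a); first by rewrite addr_ge0// mulr_ge0 ?powR_ge0.
exists k => N p M xi phi d sp pM d01 xid Nd; case/andP: (d01) => d0 d1.
have M0 : 0 <= M by apply: le_trans (pM 0 _) => //; apply/andP; split; lra.
have cf : continuous (fun x => wpoly a p x * cos (xi * x + phi)).
  by apply: continuous_phase_cos; exact: continuous_wpoly.
have fle x : `|wpoly a p x * cos (xi * x + phi)| <= `|wpoly a p x|.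
  by rewrite normrM ler_piMr// cos_max.
have E1 : `|\int[mu]_(x in `[-1, -1 + d]) (wpoly a p x * cos (xi * x + phi))|
    <= (2 * d) `^ a * M * d.
  have := @norm_Rintegral_itvcc_le _ (-1) (-1 + d) ((2 * d) `^ a * M) _ cf _.
  have -> : -1 + d - -1 = d by ring.
  apply => [|x /andP[x1 x2]]; first lra.
  apply: le_trans (fle x) (wpoly_edge a0 (ltW d0) _ pM).
  by rewrite ler0_norm; [apply/andP; split|]; lra.
have E3 : `|\int[mu]_(x in `[1 - d, 1]) (wpoly a p x * cos (xi * x + phi))|
    <= (2 * d) `^ a * M * d.
  have := @norm_Rintegral_itvcc_le _ (1 - d) 1 ((2 * d) `^ a * M) _ cf _.
  have -> : 1 - (1 - d) = d by ring.
  apply => [|x /andP[x1 x2]]; first lra.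
  apply: le_trans (fle x) (wpoly_edge a0 (ltW d0) _ pM).
  by rewrite ger0_norm; [apply/andP; split|]; lra.
have E2 : \int[mu]_(x in `[-1 + d, 1 - d]) (wpoly a p x * cos (xi * x + phi)) =
    \int[mu]_(x in `[-1 + d, 1 - d]) osc a p xi phi x.
  apply: eq_Rintegral => x; rewrite inE/= in_itv/= => /andP[x1 x2].
  by rewrite /osc /wpoly max_r//; nra.
have := HC N p M xi phi d sp pM d01 xid Nd; rewrite -E2 {E2} => E2.
rewrite (@Rintegral_itvcc_split _ (-1) (-1 + d))//; last by apply/andP; split; lra.
rewrite (@Rintegral_itvcc_split _ (-1 + d) (1 - d) 1)//; last by apply/andP; split; lra.
have dE : (2 * d) `^ a * d = 2 `^ a * d `^ (a + 1).
  by rewrite powRD ?(gt_eqF d0) ?implybT// powRM ?ltW// powRr1 ?ltW// mulrA.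
rewrite mulrAC dE in E1 E3.
set J1 := \int[_]_(_ in _) _ in E1 *; set J2 := \int[_]_(_ in _) _ in E2 *.
set J3 := \int[_]_(_ in _) _ in E3 *.
have := ler_normD J1 (J2 + J3); have := ler_normD J2 J3; lra.
Qed.

(* Near a maximum point of [|p|], Markov keeps [|p|] above half its maximum on an
   interval of length [~ N ^- 2] at distance at least [~ N ^- 2] from [-1] and [1]. *)
Lemma nikolskii a N p : 0 < a -> (0 < N)%N -> (size p <= N.+1)%N ->
  exists2 M : R, forall x, -1 <= x <= 1 -> `|p.[x]| <= M &
    M ^+ 2 <= 32 * 16 `^ (2 * a) * N%:R `^ (4 * a + 2) *
      \int[mu]_(x in `[-1, 1]) wpoly a p x ^+ 2.
Proof.
move=> a0 N0 sp.
have cp : continuous (fun x => `|p.[x]|).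
  by move=> x; apply: cvg_norm; exact: is_derive_continuous (is_derive_poly p x).
have [||x0 x01 x0max] := @EVT_max R (fun x => `|p.[x]|) (-1) 1; first lra.
  by apply: continuous_in_subspaceT => x _; exact: cp.
rewrite in_itv/= in x01; pose M : R := `|p.[x0]|; exists M.
  by move=> x x1; apply: x0max; rewrite in_itv.
have pM x : -1 <= x <= 1 -> `|p.[x]| <= M by move=> x1; apply: x0max; rewrite in_itv.
have M0 : 0 <= M by exact: normr_ge0.
(* By Markov [|p|] varies by at most [2 N ^ 2 M r = M / 2] over a distance [r]. *)
pose r : R := (4 * N%:R ^+ 2)^-1.
have N1 : 1 <= N%:R ^+ 2 :> R by rewrite exprn_ege1// ler1n.
have r0 : 0 < r by rewrite invr_gt0; lra.
have rN : N%:R ^+ 2 * r = 4^-1 by rewrite /r; field; rewrite pnatr_eq0 -lt0n.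
have r4 : r <= 4^-1 by rewrite lef_pV2 ?posrE; lra.
have near_max x : -1 <= x <= 1 -> `|x - x0| <= r -> M / 2 <= `|p.[x]|.
  move=> x1 xr.
  have lip (s t : R) : -1 <= s <= 1 -> -1 <= t <= 1 -> s < t ->
      `|p.[t] - p.[s]| <= 2 * N%:R ^+ 2 * M * (t - s).
    move=> /andP[s1 s2] /andP[t1 t2] st.
    have [c] := polyrcf.poly_mvt p st; rewrite in_itv/= => /andP[sc ct] ->.
    rewrite normrM (gtr0_norm (_ : 0 < t - s)) ?subr_gt0// ler_pM2r ?subr_gt0//.
    by apply: (markov sp pM); apply/andP; split; lra.
  have : `|p.[x] - p.[x0]| <= 2 * N%:R ^+ 2 * M * `|x - x0|.
    have [xx0|xx0|->] := ltgtP x x0.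
    - by rewrite distrC [X in _ * X]distrC [X in _ * X]gtr0_norm ?subr_gt0// lip.
    - by rewrite [X in _ * X]gtr0_norm ?subr_gt0// lip.
    - by rewrite !subrr normr0 mulr0.
  have K0 : 0 <= 2 * N%:R ^+ 2 * M by rewrite !mulr_ge0.
  have := ler_wpM2l K0 xr.
  have -> : 2 * N%:R ^+ 2 * M * r = 2 * (N%:R ^+ 2 * r) * M by ring.
  rewrite rN; have := ler_normB p.[x] (p.[x] - p.[x0]).
  by rewrite opprB addrC subrK -/M; lra.
have cw2 : continuous (fun x => wpoly a p x ^+ 2).
  move=> x; have cw := @continuous_wpoly a p a0 x.
  exact: (cvgM cw cw).
(* An admissible interval lies on the side of [x0] facing the origin. *)
have [l [l1 l2 l3 l4]] : exists l : R, [/\ -1 + r / 2 <= l, l + r / 2 <= 1 - r / 2,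
    x0 - r <= l & l + r / 2 <= x0 + r].
  by case: (leP 0 x0) => x00; [exists (x0 - r)|exists (x0 + r / 2)]; split; lra.
have wlow x : l <= x <= l + r / 2 -> (r / 4) `^ (2 * a) * (M ^+ 2 / 4) <= wpoly a p x ^+ 2.
  move=> /andP[x1 x2]; rewrite /wpoly exprMn.
  have w0 : r / 4 <= 1 - x ^+ 2 by nra.
  rewrite max_r; last lra.
  have -> : (1 - x ^+ 2) `^ a ^+ 2 = (1 - x ^+ 2) `^ (2 * a).
    by rewrite -powR_mulrn ?powR_ge0// -powRrM mulrC.
  apply: ler_pM; [exact: powR_ge0|by rewrite divr_ge0 ?sqr_ge0| |].
    by rewrite ge0_ler_powR ?nnegrE ?mulr_ge0//; lra.
  have h : M / 2 <= `|p.[x]|.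
    by apply: near_max; [apply/andP; split; lra|rewrite ler_norml; apply/andP; split; lra].
  rewrite -(real_normK (num_real p.[x])).
  have -> : M ^+ 2 / 4 = (M / 2) ^+ 2 by field.
  by rewrite ler_sqr ?nnegrE// divr_ge0.
have : \int[mu]_(x in `[l, l + r / 2]) (cst ((r / 4) `^ (2 * a) * (M ^+ 2 / 4)) x)
    <= \int[mu]_(x in `[-1, 1]) wpoly a p x ^+ 2.
  rewrite (@Rintegral_itvcc_split _ (-1) l)//; last by apply/andP; split; lra.
  rewrite (@Rintegral_itvcc_split _ l (l + r / 2) 1)//; last by apply/andP; split; lra.
  apply: (@le_trans _ _ (\int[mu]_(x in `[l, l + r / 2]) wpoly a p x ^+ 2)).
    apply: le_Rintegral => //; first by apply: integrable_itvcc => x _; exact: cvg_cst.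
    by apply: integrable_itvcc => x _; exact: cw2.
  rewrite addrCA lerDl addr_ge0// Rintegral_ge0// => x _; exact: sqr_ge0.
rewrite Rintegral_cst//= lebesgue_measure_itv/= lte_fin ltrDl divr_gt0//=.
rewrite addrC addKr.
set I := \int[_]_(_ in _) _ => hI.
have NE : N%:R `^ (4 * a + 2) = N%:R ^+ 2 * (N%:R ^+ 2) `^ (2 * a) :> R.
  have NN : N%:R != 0 :> R by rewrite pnatr_eq0 -lt0n.
  rewrite powRD ?NN ?implybT// powR_mulrn// mulrC -powR_mulrn// -powRrM.
  by congr (_ * _ `^ _); ring.
(* The constants are chosen to cancel: [16 N ^ 2 (r / 4) = 1] under the power, and
   [32 (1 / 4) (1 / 2) N ^ 2 r = 1] for the rest. *)
have rE : 16 `^ (2 * a) * (N%:R ^+ 2) `^ (2 * a) * (r / 4) `^ (2 * a) = 1 :> R.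
  rewrite -!powRM ?mulr_ge0 ?exprn_ge0 ?ler0n ?(ltW r0)//.
  by rewrite (_ : _ * _ * _ = 1) ?powR1//; move: rN; set X := N%:R ^+ 2 => ?; nra.
have K0 : 0 <= 32 * 16 `^ (2 * a) * N%:R `^ (4 * a + 2) :> R by rewrite !mulr_ge0 ?powR_ge0.
have := ler_wpM2l K0 hI; apply: le_trans; rewrite NE.
set X := 16 `^ _ in rE *; set Y := _ `^ (2 * a) in rE *; set Z := _ `^ (2 * a) in rE *.
have -> : 32 * X * (N%:R ^+ 2 * Y) * (Z * (M ^+ 2 / 4) * (r / 2)) =
  4 * (X * Y * Z) * (N%:R ^+ 2 * r) * M ^+ 2 by field.
by rewrite rE rN; lra.
Qed.

End WeightedPolynomial.

(** * Bessel's inequality *)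

Section BesselInequality.
Variable R : realType.
Local Notation mu := (@lebesgue_measure R).
Implicit Types (x xi t l r k : R) (f g w : R -> R).

Lemma Rintegral_itvccD f g l r : continuous f -> continuous g ->
  \int[mu]_(x in `[l, r]) (f x + g x) =
  \int[mu]_(x in `[l, r]) f x + \int[mu]_(x in `[l, r]) g x.
Proof.
by move=> cf cg; rewrite RintegralD//; apply: integrable_itvcc => x _; [exact: cf|exact: cg].
Qed.

Lemma Rintegral_itvccZ f k l r : continuous f ->
  \int[mu]_(x in `[l, r]) (k * f x) = k * \int[mu]_(x in `[l, r]) f x.
Proof.
by move=> cf; rewrite RintegralZl//; apply: integrable_itvcc => x _; exact: cf.
Qed.

Lemma continuousDf f g : continuous f -> continuous g -> continuous (fun x => f x + g x).
Proof. by move=> cf cg x; apply: cvgD; [exact: cf|exact: cg]. Qed.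

Lemma continuousMf f g : continuous f -> continuous g -> continuous (fun x => f x * g x).
Proof. by move=> cf cg x; apply: cvgM; [exact: cf|exact: cg]. Qed.

Lemma continuousZf f k : continuous f -> continuous (fun x => k * f x).
Proof. by move=> cf; apply: continuousMf => // x; exact: cvg_cst. Qed.

Lemma continuous_cosZ k : continuous (fun x => cos (k * x)).
Proof.
move=> x; rewrite (_ : (fun x => _) = (fun x => cos (k * x + 0))).
  exact: is_derive_continuous (is_derive_phase_cos k 0 x).
by apply/funext => y; rewrite addr0.
Qed.

Lemma continuous_sinZ k : continuous (fun x => sin (k * x)).
Proof.
move=> x; rewrite (_ : (fun x => _) = (fun x => sin (k * x + 0))).
  exact: is_derive_continuous (is_derive_phase_sin k 0 x).
by apply/funext => y; rewrite addr0.
Qed.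

Lemma Rintegral_cos_period (j : nat) : (0 < j)%N ->
  \int[mu]_(x in `[- pi, pi]) cos (j%:R * x) = 0.
Proof.
move=> j0; have jn0 : j%:R != 0 :> R by rewrite pnatr_eq0 -lt0n.
pose F x := j%:R^-1 * sin (j%:R * x).
have -> : \int[mu]_(x in `[- pi, pi]) cos (j%:R * x) = F pi - F (- pi).
  apply: Rintegral_FTC2 => [|x _|x _]; last exact: continuous_cosZ.
    by have := @pi_gt0 R; lra.
  have h := is_derive_phase_sin j%:R 0 x.
  rewrite /F (_ : (fun x => _ * sin _) = (fun x => j%:R^-1 * sin (j%:R * x + 0))).
    by apply: is_derive_eq; rewrite /GRing.scale/= addr0; field.
  by apply/funext => y; rewrite addr0.
rewrite /F mulrN sinN (_ : sin (j%:R * pi) = 0) ?oppr0 ?mulr0 ?subrr//.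
elim: {j0 jn0 F} j => [|j IH]; first by rewrite mul0r sin0.
by rewrite -natr1 mulrDl mul1r sinDpi IH oppr0.
Qed.

Lemma Rintegral_sin_period (j : nat) : (0 < j)%N ->
  \int[mu]_(x in `[- pi, pi]) sin (j%:R * x) = 0.
Proof.
move=> j0; have jn0 : j%:R != 0 :> R by rewrite pnatr_eq0 -lt0n.
pose F x := - j%:R^-1 * cos (j%:R * x).
have -> : \int[mu]_(x in `[- pi, pi]) sin (j%:R * x) = F pi - F (- pi).
  apply: Rintegral_FTC2 => [|x _|x _]; last exact: continuous_sinZ.
    by have := @pi_gt0 R; lra.
  have h := is_derive_phase_cos j%:R 0 x.
  rewrite /F (_ : (fun x => _ * cos _) = (fun x => - j%:R^-1 * cos (j%:R * x + 0))).
    by apply: is_derive_eq; rewrite /GRing.scale/= addr0; field.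
  by apply/funext => y; rewrite addr0.
by rewrite /F mulrN cosN subrr.
Qed.

Definition fcos w xi := \int[mu]_(x in `[-1, 1]) (w x * cos (xi * x)).
Definition fsin w xi := \int[mu]_(x in `[-1, 1]) (w x * sin (xi * x)).
(** The squared modulus of the Fourier transform, for [w] supported in [-1, 1]. *)
Definition spectrum w xi := fcos w xi ^+ 2 + fsin w xi ^+ 2.

Variables (w : R -> R) (t : R).
Hypothesis cw : continuous w.

Let c i := fcos w (t + i%:R).
Let s i := fsin w (t + i%:R).
(** [u i] and [v i] are the real and imaginary parts of [(c i - i s i) e ^ (i (t + i) x)], the
    Fourier coefficient times its exponential. Thus [g n] and [h n] are those of [2 pi] times the
    orthogonal projection of [w] in L2 of [-pi, pi]. *)
Let u i x := c i * cos ((t + i%:R) * x) + s i * sin ((t + i%:R) * x).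
Let v i x := c i * sin ((t + i%:R) * x) + (- s i) * cos ((t + i%:R) * x).
Let g n x := \sum_(i < n) u i x.
Let h n x := \sum_(i < n) v i x.
Let S n := \sum_(i < n) spectrum w (t + i%:R).

Let gS n x : g n.+1 x = g n x + u n x.
Proof. by rewrite /g big_ord_recr. Qed.

Let hS n x : h n.+1 x = h n x + v n x.
Proof. by rewrite /h big_ord_recr. Qed.

Let cu i : continuous (u i).
Proof.
by apply: continuousDf; apply: continuousZf;
  [exact: continuous_cosZ|exact: continuous_sinZ].
Qed.

Let cv i : continuous (v i).
Proof.
by apply: continuousDf; apply: continuousZf;
  [exact: continuous_sinZ|exact: continuous_cosZ].
Qed.

Let cg n : continuous (g n).
Proof.
elim: n => [|n IH]; last first.
  rewrite (_ : g n.+1 = (fun x => g n x + u n x)); last exact/funext.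
  exact: continuousDf.
rewrite (_ : g 0 = cst 0); first by move=> x; exact: cvg_cst.
by apply/funext => x; rewrite /g big_ord0.
Qed.

Let ch n : continuous (h n).
Proof.
elim: n => [|n IH]; last first.
  rewrite (_ : h n.+1 = (fun x => h n x + v n x)); last exact/funext.
  exact: continuousDf.
rewrite (_ : h 0 = cst 0); first by move=> x; exact: cvg_cst.
by apply/funext => x; rewrite /h big_ord0.
Qed.

Let int0 l r f : (forall x, f x = 0) -> \int[mu]_(x in `[l, r]) f x = 0.
Proof.
move=> f0; rewrite (_ : f = cst 0); last exact/funext.
by rewrite Rintegral_cst//= mul0r.
Qed.

(** The integrand is the real part of a Hermitian product. Each index [i < n] contributes a cosine
    and a sine of nonzero integer frequency [m - i], the shift [t] having cancelled, and these
    vanish over a period. *)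
Let int_cross n m : (n <= m)%N ->
  \int[mu]_(x in `[- pi, pi]) (g n x * u m x + h n x * v m x) = 0.
Proof.
elim: n => [|n IH] nm.
  by apply: int0 => x; rewrite /g /h !big_ord0 !mul0r addr0.
pose A := c n * c m + s n * s m; pose B := c n * s m - s n * c m.
have -> : (fun x => g n.+1 x * u m x + h n.+1 x * v m x) =
    (fun x => (g n x * u m x + h n x * v m x) +
      (A * cos ((m - n)%:R * x) + B * sin ((m - n)%:R * x))).
  apply/funext => x; rewrite gS hS natrB 1?ltnW//.
  have -> : (m%:R - n%:R) * x = (t + m%:R) * x - (t + n%:R) * x by ring.
  by rewrite cosB sinB /u /v /A /B; ring.
have c1 := @continuous_cosZ (m - n)%:R; have c2 := @continuous_sinZ (m - n)%:R.
rewrite Rintegral_itvccD; first last.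
- by apply: continuousDf; exact: continuousZf.
- by apply: continuousDf; exact: continuousMf.
rewrite IH 1?ltnW// Rintegral_itvccD; [|exact: continuousZf|exact: continuousZf].
rewrite !Rintegral_itvccZ// Rintegral_cos_period ?Rintegral_sin_period ?subn_gt0//.
by rewrite !mulr0 !addr0.
Qed.

(** Pythagoras: the cross terms vanish, and [u n ^ 2 + v n ^ 2] is the constant
    [spectrum w (t + n)]. *)
Let int_gh n : \int[mu]_(x in `[- pi, pi]) (g n x ^+ 2 + h n x ^+ 2) = 2 * pi * S n.
Proof.
elim: n => [|n IH].
  rewrite /S big_ord0 mulr0; apply: int0 => x.
  by rewrite /g /h !big_ord0 expr0n addr0.
have -> : (fun x => g n.+1 x ^+ 2 + h n.+1 x ^+ 2) =
    (fun x => (g n x * g n x + h n x * h n x) +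
      (2 * (g n x * u n x + h n x * v n x) + cst (spectrum w (t + n%:R)) x)).
  apply/funext => x; rewrite gS hS /=.
  have -> : spectrum w (t + n%:R) = u n x ^+ 2 + v n x ^+ 2.
    transitivity ((c n ^+ 2 + s n ^+ 2) *
        (cos ((t + n%:R) * x) ^+ 2 + sin ((t + n%:R) * x) ^+ 2)).
      by rewrite cos2Dsin2 mulr1.
    by rewrite /u /v; ring.
  by ring.
have c1 : continuous (fun x => g n x * u n x + h n x * v n x).
  by apply: continuousDf; exact: continuousMf.
have c2 : continuous (cst (spectrum w (t + n%:R)) : R -> R) by move=> x; exact: cvg_cst.
rewrite Rintegral_itvccD; first last.
- by apply: continuousDf => //; exact: continuousZf.
- by apply: continuousDf; exact: continuousMf.
rewrite [X in _ + X = _]Rintegral_itvccD//; last exact: continuousZf.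
rewrite Rintegral_itvccZ// int_cross// mulr0 add0r.
have -> : \int[mu]_(x in `[- pi, pi]) (g n x * g n x + h n x * h n x) = 2 * pi * S n by exact: IH.
rewrite Rintegral_cst//= lebesgue_measure_itv/= lte_fin gtrN ?pi_gt0//=.
rewrite /S big_ord_recr/=; ring.
Qed.

Let int_wg n : \int[mu]_(x in `[-1, 1]) (w x * g n x) = S n.
Proof.
elim: n => [|n IH].
  by rewrite /S big_ord0; apply: int0 => x; rewrite /g big_ord0 mulr0.
have -> : (fun x => w x * g n.+1 x) = (fun x => w x * g n x +
    (c n * (w x * cos ((t + n%:R) * x)) + s n * (w x * sin ((t + n%:R) * x)))).
  by apply/funext => x; rewrite gS /u; ring.
have c1 := continuousMf cw (@continuous_cosZ (t + n%:R)).
have c2 := continuousMf cw (@continuous_sinZ (t + n%:R)).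
rewrite Rintegral_itvccD; first last.
- by apply: continuousDf; exact: continuousZf.
- exact: continuousMf.
rewrite Rintegral_itvccD; [|exact: continuousZf|exact: continuousZf].
by rewrite !Rintegral_itvccZ// IH /S big_ord_recr/= /spectrum !expr2.
Qed.

(* The exponentials [e ^ (i (t + n) x)] are orthogonal on [-pi, pi], which
   contains the support of [w]. *)
Lemma bessel n : \sum_(i < n) spectrum w (t + i%:R) <=
  2 * pi * \int[mu]_(x in `[-1, 1]) w x ^+ 2.
Proof.
rewrite -/(S n); pose q : R := (2 * pi)^-1.
have pi0 := @pi_gt0 R; have q0 : 0 < q by rewrite invr_gt0 mulr_gt0.
pose gh x := g n x * g n x + h n x * h n x.
have cgh : continuous gh by apply: continuousDf; exact: continuousMf.
have cww := continuousMf cw cw; have cwg := continuousMf cw (cg (n := n)).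
have gh0 x : 0 <= gh x by rewrite /gh -!expr2 addr_ge0 ?sqr_ge0.
(* The squared distance from [w] to its projection, restricted to [-1, 1]. With [J] the integral of
   [w ^ 2], expanding gives [0 <= J - 2 q S + q ^ 2 I], and enlarging the interval gives
   [q ^ 2 I <= q S]. *)
have : 0 <= \int[mu]_(x in `[-1, 1]) ((w x - q * g n x) ^+ 2 + (q * h n x) ^+ 2).
  by rewrite Rintegral_ge0// => x _; rewrite addr_ge0 ?sqr_ge0.
have -> : (fun x => (w x - q * g n x) ^+ 2 + (q * h n x) ^+ 2) =
    (fun x => w x * w x + (- (2 * q) * (w x * g n x) + q ^+ 2 * gh x)).
  by apply/funext => x; rewrite /gh; ring.
rewrite Rintegral_itvccD//; last by apply: continuousDf; exact: continuousZf.
rewrite Rintegral_itvccD; [|exact: continuousZf|exact: continuousZf].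
rewrite !Rintegral_itvccZ// int_wg.
have : \int[mu]_(x in `[-1, 1]) gh x <= 2 * pi * S n.
  rewrite -int_gh -[X in _ <= X]/(\int[mu]_(x in `[- pi, pi]) gh x).
  have pi2 := @pi_ge2 R.
  rewrite (@Rintegral_itvcc_split _ _ (- pi) (-1))//; last by apply/andP; split; lra.
  rewrite (@Rintegral_itvcc_split _ _ (-1) 1 pi)//; last by apply/andP; split; lra.
  by rewrite addrCA lerDl addr_ge0// Rintegral_ge0.
set I := \int[_]_(_ in _) gh _; set J := \int[_]_(_ in _) (w _ * w _).
rewrite -[X in _ -> _ -> _ <= _ * X]/J => h1 h2.
have qE : q * (2 * pi) = 1 by rewrite mulVf// gt_eqF// mulr_gt0.
have h3 : q ^+ 2 * I <= q * S n.
  have := ler_wpM2l (sqr_ge0 q) h1.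
  have -> : q ^+ 2 * (2 * pi * S n) = q * (2 * pi) * (q * S n) by ring.
  by rewrite qE mul1r.
have h4 : q * S n <= J by lra.
have := ler_wpM2l (ltW (mulr_gt0 (ltr0n _ 2) pi0)) h4.
by rewrite mulrA [2 * pi * q]mulrC qE mul1r.
Qed.

End BesselInequality.

(** * Continuity of the spectrum and its integral over low frequencies *)

Section SpectralBounds.
Variable R : realType.
Local Notation mu := (@lebesgue_measure R).
Implicit Types (x xi l r a c : R) (f w : R -> R) (p : {poly R}).

Lemma EFin_Rintegral_itvcc f l r : continuous f ->
  (\int[mu]_(x in `[l, r]) (f x)%:E)%E = (\int[mu]_(x in `[l, r]) f x)%:E.
Proof.
move=> cf; rewrite /Rintegral fineK//; apply: integrable_fin_num => //.
by apply: integrable_itvcc => x _; exact: cf.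
Qed.

(** Dominated convergence with majorant [|w|]; [e] stands for both cosine and sine. *)
Lemma continuous_oscillatory_transform w (e : R -> R) : continuous w -> continuous e ->
  (forall x, `|e x| <= 1) ->
  continuous (fun xi => \int[mu]_(x in `[-1, 1]) (w x * e (xi * x))).
Proof.
move=> cw ce e1 xi.
have cM (k : R) : continuous (fun x => e (k * x)).
  move=> x; apply: (@continuous_comp _ _ _ (fun x : R => k * x) e); last exact: ce.
  exact: mulrl_continuous.
have := @continuity_under_integral R _ _ mu (fun xi x => w x * e (xi * x)) `[-1, 1]%classic
  _ (xi - 1) (xi + 1) _ _ (fun x => `|w x|) _ _.
apply => //.
- by move=> y _; apply: integrable_itvcc => x _; exact: (continuousMf cw (@cM y)).
- apply: aeW => x _ y _.
  apply: cvgM; first exact: cvg_cst.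
  apply: (@continuous_comp _ _ _ (fun y : R => y * x) e); last exact: ce.
  exact: mulrr_continuous.
- by apply: integrable_itvcc => x _; apply: cvg_norm; exact: cw.
- by move=> y _; apply: aeW => x _; rewrite normrM ler_piMr.
- by rewrite inE/= in_itv/=; apply/andP; split; lra.
Qed.

Lemma continuous_spectrum w : continuous w -> continuous (spectrum w).
Proof.
move=> cw; have cc : continuous (fcos w).
  by apply: continuous_oscillatory_transform => //; [exact: continuous_cos|exact: cos_max].
have cs : continuous (fsin w).
  by apply: continuous_oscillatory_transform => //; [exact: continuous_sin|exact: sin_max].
exact: (continuousDf (continuousMf cc cc) (continuousMf cs cs)).
Qed.

Lemma fsinN w xi : continuous w -> fsin w (- xi) = - fsin w xi.
Proof.
move=> cw; rewrite /fsin; under eq_Rintegral do rewrite mulNr sinN mulrN -mulN1r.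
by rewrite Rintegral_itvccZ ?mulN1r//; apply: continuousMf => //; exact: continuous_sinZ.
Qed.

Lemma spectrumN w xi : continuous w -> spectrum w (- xi) = spectrum w xi.
Proof.
move=> cw; rewrite /spectrum fsinN// sqrrN /fcos.
by under eq_Rintegral do rewrite mulNr cosN.
Qed.

Lemma spectrum_ge0 w xi : 0 <= spectrum w xi.
Proof. by rewrite addr_ge0 ?sqr_ge0. Qed.

Lemma continuous_translate f c : continuous f -> continuous (fun x => f (x + c)).
Proof.
move=> cf x; apply: (@continuous_comp _ _ _ (fun x : R => x + c) f); last exact: cf.
by apply: cvgD; [exact: cvg_id|exact: cvg_cst].
Qed.

Lemma continuous_sum_translates f n : continuous f ->
  continuous (fun x => \sum_(i < n) f (x + i%:R)).
Proof.
move=> cf; elim: n => [|n IH].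
  rewrite (_ : (fun x => _) = cst 0); first by move=> x; exact: cvg_cst.
  by apply/funext => x; rewrite big_ord0.
rewrite (_ : (fun x => _) = (fun x => \sum_(i < n) f (x + i%:R) + f (x + n%:R))).
  by apply: continuousDf => //; exact: continuous_translate.
by apply/funext => x; rewrite big_ord_recr.
Qed.

Lemma Rintegral_itvcc_translate f l r c : l < r -> continuous f ->
  \int[mu]_(x in `[l + c, r + c]) f x = \int[mu]_(x in `[l, r]) f (x + c).
Proof.
(* The base point lies one unit to the left of the interval, so that [G] has a two-sided derivative
   at [l + c] too. *)
move=> lr cf; pose G y := \int[mu]_(x in `[l + c - 1, y]) f x.
have dG x : l + c - 1 < x -> is_derive x (1 : R) G (f x).
  move=> lx; have xx1 : x < x + 1 by lra.
  have [|dGx Gx] := @continuous_FTC1_closed R f _ x _ xx1 _ lx (cf x).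
    by apply: integrable_itvcc => y _; exact: cf.
  by apply: (DeriveDef dGx); rewrite -derive1E; exact: Gx.
transitivity (G (r + c) - G (l + c)).
  apply: Rintegral_FTC2 => [|x /andP[lx _]|x _]; [lra| |exact: cf].
  by apply: dG; lra.
symmetry; apply: (@Rintegral_FTC2 _ _ (fun x => G (x + c))) => //.
- move=> x /andP[lx _]; have h : is_derive x (1 : R) (fun x : R => x + c) 1.
    by apply: is_derive_eq; rewrite addr0.
  have := is_derive_comp1 h (dG (x + c) _); rewrite mulr1; apply; lra.
- by move=> x _; exact: continuous_translate.
Qed.

(** Folding [0, n] onto its first unit cell turns a frequency integral into an average over [t] in
    [0, 1] of the sums that [bessel] controls. *)
Lemma Rintegral_itvcc_nat f n : continuous f ->
  \int[mu]_(x in `[0, n%:R]) f x = \int[mu]_(x in `[0, 1]) \sum_(i < n) f (x + i%:R).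
Proof.
move=> cf.
have ct := continuous_translate cf; have cS := continuous_sum_translates cf.
elim: n => [|n IH].
  rewrite set_itv1 Rintegral_set1; under eq_Rintegral do rewrite big_ord0.
  by rewrite Rintegral_cst//= mul0r.
under [RHS]eq_Rintegral do rewrite big_ord_recr/=.
rewrite (Rintegral_itvccD _ _ (cS n) (ct n%:R)) -IH.
rewrite -Rintegral_itvcc_translate ?ltr01//.
by rewrite add0r [1 + _]addrC natr1 -Rintegral_itvcc_split// ler0n ler_nat leqnSn.
Qed.

Lemma spectrum_low_frequency w n : continuous w ->
  \int[mu]_(xi in `[0, n%:R]) spectrum w xi <= 2 * pi * \int[mu]_(x in `[-1, 1]) w x ^+ 2.
Proof.
move=> cw; have cs := continuous_spectrum cw.
rewrite Rintegral_itvcc_nat//.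
set W := 2 * pi * _.
have -> : W = W * (1 - 0) by rewrite subr0 mulr1.
rewrite (le_trans (ler_norm _))// norm_Rintegral_itvcc_le ?ler01//.
  exact: continuous_sum_translates.
by move=> x _; rewrite ger0_norm ?sumr_ge0 ?bessel// => i _; exact: spectrum_ge0.
Qed.

End SpectralBounds.

(** * The energy bound *)

Section EnergyBound.
Variable R : realType.
Local Notation mu := (@lebesgue_measure R).
Implicit Types (x xi a M : R) (p : {poly R}).

(** Take [d = 1 / xi] in the decay estimate, with phase 0 for the cosine part and [- pi / 2] for the
    sine part; the powers combine to [2 a - 2 (a + 1) = -2]. *)
Lemma spectrum_wpoly_decay a : 0 < a ->
  exists2 C : R, 0 <= C & exists k, forall N p M xi, (size p <= N.+1)%N ->
    (forall x, -1 <= x <= 1 -> `|p.[x]| <= M) ->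
    1 < xi -> 4 * (N + k)%:R ^+ 2 <= xi ->
    xi `^ (2 * a) * spectrum (wpoly a p) xi <= C * M ^+ 2 * xi ^- 2.
Proof.
move=> a0; have [C C0 [k HC]] := wpoly_fourier_decay a0.
exists (2 * C ^+ 2); first by rewrite mulr_ge0 ?sqr_ge0.
exists k => N p M xi sp pM xi1 Nxi; have xi0 : 0 < xi by lra.
have M0 : 0 <= M by apply: le_trans (pM 0 _) => //; apply/andP; split; lra.
have d01 : 0 < xi^-1 < 1 by rewrite invr_gt0 xi0 invf_lt1.
have xid : `|xi| * xi^-1 = 1 by rewrite gtr0_norm// divff// gt_eqF.
have Nd : 4 * (N + k)%:R ^+ 2 * xi^-1 <= 1 by rewrite ler_pdivrMr// mul1r.
have H phi := HC N p M xi phi xi^-1 sp pM d01 xid Nd.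
set B := C * xi^-1 `^ (a + 1) * M in H.
have B0 : 0 <= B by rewrite !mulr_ge0 ?powR_ge0.
have sq y : `|y| <= B -> y ^+ 2 <= B ^+ 2.
  by move=> yB; rewrite -(real_normK (num_real y)) ler_sqr ?nnegrE.
have hc : fcos (wpoly a p) xi ^+ 2 <= B ^+ 2.
  apply: sq; rewrite /fcos; under eq_Rintegral do rewrite -[xi * _]addr0.
  exact: H.
have hs : fsin (wpoly a p) xi ^+ 2 <= B ^+ 2.
  apply: sq; rewrite /fsin; under eq_Rintegral do rewrite -cosBpihalf.
  exact: H.
have pE : xi `^ (2 * a) * (xi^-1 `^ (a + 1)) ^+ 2 = xi ^- 2.
  rewrite -powR_inv1 ?ltW// -powRrM -powR_mulrn ?powR_ge0// -powRrM.
  rewrite -powRD ?(gt_eqF xi0) ?implybT//.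
  have -> : 2 * a + -1 * (a + 1) * 2 = - 2%:R by ring.
  by rewrite powR_invn// ltW.
apply: (@le_trans _ _ (xi `^ (2 * a) * (2 * B ^+ 2))).
  by rewrite ler_wpM2l ?powR_ge0// /spectrum; lra.
rewrite le_eqVlt; apply/orP; left; apply/eqP.
rewrite -pE /B; ring.
Qed.

Lemma within_continuous_inv_sqr (A K : R) : 0 < A ->
  {within `[A, +oo[, continuous (fun x => K * x ^- 2)}.
Proof.
move=> A0; apply: continuous_in_subspaceT => x; rewrite inE/= in_itv/= andbT => Ax.
apply: cvgM; first exact: cvg_cst.
apply: cvgV; first by rewrite expf_neq0// lt0r_neq0// (lt_le_trans A0).
exact: exprn_continuous.
Qed.

Lemma integral_inv_sqr (A K : R) : 0 < A -> 0 <= K ->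
  (\int[mu]_(x in `[A, +oo[) (K * x ^- 2)%:E)%E = (K / A)%:E.
Proof.
move=> A0 K0; pose F x := - K * x^-1.
have dF x : 0 < x -> is_derive x (1 : R) F (K * x ^- 2).
  move=> x0; have h := @is_deriveV R id x 1 1 (lt0r_neq0 x0) (is_derive_id x 1).
  rewrite /F; apply: is_derive_eq; rewrite /GRing.scale/=; ring.
rewrite (@ge0_continuous_FTC2y R (fun x => K * x ^- 2) F A 0).
- by rewrite sub0e -EFinN /F mulNr opprK.
- by move=> x Ax; rewrite mulr_ge0// invr_ge0 sqr_ge0.
- exact: within_continuous_inv_sqr.
- rewrite -[X in _ --> X](mulr0 (- K)); apply: cvgM; first exact: cvg_cst.
  apply/gtr0_cvgV0; last exact: cvg_id.
  exact: nbhs_pinfty_gt.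
- by move=> x Ax; case: (dF x _) => //; lra.
- apply: cvg_at_right_filter; exact: (is_derive_continuous (dF _ A0)).
- move=> x; rewrite in_itv/= andbT => Ax.
  by have [_ <-] := dF x (lt_trans A0 Ax); rewrite derive1E.
Qed.

Lemma wpoly_energy_bound a : 0 < a ->
  exists2 C : R, 0 < C & forall N p, (0 < N)%N -> (size p <= N.+1)%N ->
    (\int[mu]_xi (`|xi| `^ (2 * a) * spectrum (wpoly a p) xi)%:E
       <= (C * N%:R `^ (4 * a) * \int[mu]_(x in `[-1, 1]) wpoly a p x ^+ 2)%:E)%E.
Proof.
move=> a0; have [D D0 [k HD]] := spectrum_wpoly_decay a0.
(* [b] satisfies [A <= b N ^ 2] because [N + k <= (k + 1) N]; [C3] is the constant of
   [nikolskii]. *)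
pose b : R := 4 * k.+1%:R ^+ 2; pose C3 : R := 32 * 16 `^ (2 * a).
have C30 : 0 <= C3 by rewrite mulr_ge0 ?powR_ge0.
have b0 : 0 < b by rewrite mulr_gt0// exprn_gt0.
exists (2 * (b `^ (2 * a) * (2 * pi) + D * C3)).
  by rewrite mulr_gt0// ltr_pwDl ?mulr_gt0 ?powR_gt0 ?pi_gt0 ?mulr_ge0.
move=> N p N0 sp; have [M pM HM] := nikolskii a0 N0 sp.
set W := \int[_]_(_ in _) _ in HM *.
have W0 : 0 <= W by rewrite /W Rintegral_ge0// => x _; exact: sqr_ge0.
(* A natural number, as the folding into unit cells requires, and the smallest frequency that the
   decay estimate admits. *)
pose A := (4 * (N + k) ^ 2)%N.
have AE : A%:R = 4 * (N + k)%:R ^+ 2 :> R by rewrite natrM natrX.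
have N1 : 1 <= N%:R :> R by rewrite ler1n.
have NA : N%:R ^+ 2 <= A%:R :> R.
  rewrite AE; have : N%:R ^+ 2 <= (N + k)%:R ^+ 2 :> R.
    by rewrite ler_sqr ?nnegrE// ler_nat leq_addr.
  have := sqr_ge0 ((N + k)%:R : R); lra.
have A1 : 1 < A%:R :> R.
  have : 1 <= (N + k)%:R ^+ 2 :> R by rewrite exprn_ege1// ler1n addn_gt0 N0.
  by rewrite AE; lra.
have A0 : 0 < A%:R :> R by lra.
have Ab : A%:R <= b * N%:R ^+ 2.
  rewrite AE /b -mulrA ler_wpM2l// -exprMn ler_sqr ?nnegrE ?mulr_ge0//.
  by rewrite -natrM ler_nat mulSn leq_add2l leq_pmulr.
set w := wpoly a p; have cw : continuous w by exact: continuous_wpoly.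
have cs := continuous_spectrum cw.
pose G xi := `|xi| `^ (2 * a) * spectrum w xi.
have G0 xi : 0 <= G xi by rewrite mulr_ge0 ?powR_ge0 ?spectrum_ge0.
have cG : continuous G.
  apply: continuousMf => //; have a20 : 0 < 2 * a by lra.
  have -> : (fun xi => `|xi| `^ (2 * a)) =
      (fun y => Num.max 0 y `^ (2 * a)) \o (fun xi : R => `|xi|).
    by apply/funext => xi /=; rewrite max_r.
  move=> xi; apply: continuous_comp; first exact: norm_continuous.
  exact: continuous_max0_powR.
have mG (E : set R) : measurable E -> measurable_fun E G.
  move=> mE; apply: (@measurable_funS _ _ _ _ setT) => //.
  exact: continuous_measurable_fun.
have GN : G =1 G \o -%R by move=> xi; rewrite /G/= normrN spectrumN.
(* Evenness reduces the line to the half-line, whence the leading 2 in the constant. *)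
rewrite -[X in (X <= _)%E]/(\int[mu]_xi (G xi)%:E)%E ge0_symfun_integralT//.
have -> : [set x : R | 0 <= x] = `[0, A%:R]%classic `|` `]A%:R, +oo[%classic.
  apply/seteqP; split => x /=; rewrite !in_itv/= ?andbT.
    by move=> x0; case: (leP x A%:R) => xA; [left; rewrite x0|right].
  by case=> [/andP[]//|]; lra.
rewrite ge0_integral_setU//=; first last.
- by apply/disj_setPS => x [] /=; rewrite !in_itv/= andbT; lra.
- by move=> x _; rewrite lee_fin.
- by apply/measurable_EFinP; apply: mG; exact: measurableU.
have low : (\int[mu]_(xi in `[0%R, A%:R%R]) (G xi)%:E <= (A%:R `^ (2 * a) * (2 * pi * W))%:E)%E.
  rewrite EFin_Rintegral_itvcc// lee_fin.
  have cA := continuousZf (k := A%:R `^ (2 * a)) cs.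
  apply: (@le_trans _ _ (\int[mu]_(xi in `[0, A%:R]) (A%:R `^ (2 * a) * spectrum w xi))).
    apply: le_Rintegral => //; [|by apply: integrable_itvcc => x _; exact: cA|].
      by apply: integrable_itvcc => x _; exact: cG.
    move=> xi; rewrite /= in_itv/= => /andP[xi0 xiA].
    rewrite ler_wpM2r ?spectrum_ge0// ger0_norm// ge0_ler_powR ?nnegrE//; lra.
  rewrite Rintegral_itvccZ// ler_wpM2l ?powR_ge0//.
  exact: spectrum_low_frequency.
have high : (\int[mu]_(xi in `]A%:R%R, +oo[) (G xi)%:E <= (D * M ^+ 2 / A%:R)%:E)%E.
  have DM0 : 0 <= D * M ^+ 2 by rewrite mulr_ge0 ?sqr_ge0.
  rewrite -integral_inv_sqr//.
  apply: (@le_trans _ _ (\int[mu]_(xi in `[A%:R%R, +oo[) (G xi)%:E)%E).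
    apply: ge0_subset_integral => //; first by apply/measurable_EFinP; apply: mG.
      by move=> x _; rewrite lee_fin.
    by apply: subset_itv; rewrite ?bnd_simp.
  apply: ge0_le_integral => //.
  - by move=> x _; rewrite lee_fin.
  - by apply/measurable_EFinP; apply: mG.
  - apply/measurable_EFinP; apply: subspace_continuous_measurable_fun => //.
    exact: within_continuous_inv_sqr.
  - move=> xi; rewrite /= in_itv/= andbT => Axi; rewrite lee_fin /G gtr0_norm; last lra.
  by apply: (HD N p M) => //; rewrite -?AE//; lra.
apply: le_trans (lee_wpmul2l _ (leeD low high)) _ => //.
rewrite -EFinD -EFinM lee_fin.
have lowE : A%:R `^ (2 * a) * (2 * pi * W) <= b `^ (2 * a) * (2 * pi) * N%:R `^ (4 * a) * W.
  have : A%:R `^ (2 * a) <= b `^ (2 * a) * N%:R `^ (4 * a).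
    have -> : N%:R `^ (4 * a) = (N%:R ^+ 2) `^ (2 * a) :> R.
      by rewrite -powR_mulrn// -powRrM; congr (_ `^ _); ring.
    rewrite -powRM ?sqr_ge0 ?(ltW b0)// ge0_ler_powR ?nnegrE ?mulr_ge0 ?sqr_ge0//; lra.
  have pW : 0 <= 2 * pi * W by rewrite !mulr_ge0 ?pi_ge0.
  move=> /(ler_wpM2r pW) /le_trans; apply.
  by rewrite le_eqVlt; apply/orP; left; apply/eqP; ring.
(* The surplus [N ^ 2] of [nikolskii] is cancelled by [1 / A], since [N ^ 2 <= A]. *)
have highE : D * M ^+ 2 / A%:R <= D * C3 * N%:R `^ (4 * a) * W.
  have NN : N%:R != 0 :> R by rewrite pnatr_eq0 -lt0n.
  have NE : N%:R `^ (4 * a + 2) = N%:R `^ (4 * a) * N%:R ^+ 2 :> R.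
    by rewrite powRD ?NN ?implybT// powR_mulrn.
  have K0 : 0 <= C3 * N%:R `^ (4 * a) * W by rewrite !mulr_ge0 ?powR_ge0.
  have MA : M ^+ 2 <= C3 * N%:R `^ (4 * a) * W * A%:R.
    by apply: le_trans HM _; rewrite NE -/C3; have := ler_wpM2l K0 NA; lra.
  by rewrite ler_pdivrMr//; have := ler_wpM2l D0 MA; lra.
lra.
Qed.

End EnergyBound.

(** * From the Fourier transform of the zero extension to [spectrum] *)

Section FourierOfExtension.
Variable R : realType.
Local Notation mu := (@lebesgue_measure R).
Implicit Types (x xi a : R) (u w : R -> R) (p : {poly R}).

Lemma wpoly_out a p x : 0 < a -> ~ -1 < x < 1 -> wpoly a p x = 0.
Proof.
move=> a0 x1; rewrite /wpoly max_l ?powR0 ?mul0r ?gt_eqF//.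
rewrite leNgt; apply/negP => h; apply: x1.
by rewrite -ltr_norml -(@ltr_pXn2r _ 2)// ?nnegrE// expr1n real_normK ?num_real//; lra.
Qed.

Lemma ext0_wpoly a p u : 0 < a ->
  (forall x, Lambda x -> u x = (1 - x ^+ 2) `^ a * p.[x]) -> ext0 u = wpoly a p.
Proof.
move=> a0 uE; apply/funext => x; rewrite /ext0 patchE.
case: ifPn => [|/negP]; rewrite inE => /= xL.
  rewrite uE// /wpoly max_r//; move: xL; rewrite /Lambda /= in_itv/= => /andP[x1 x2]; nra.
by rewrite wpoly_out//; apply: contra_not xL; rewrite /Lambda/= in_itv.
Qed.

Lemma Rintegral_support (f : R -> R) : (forall x, ~ -1 <= x <= 1 -> f x = 0) ->
  \int[mu]_x f x = \int[mu]_(x in `[-1, 1]) f x.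
Proof.
move=> f0; rewrite [RHS]Rintegral_mkcond; congr (Rintegral _ _ _); apply/funext => x.
by rewrite patchE; case: ifPn => // /negP; rewrite inE/= in_itv/=; exact: f0.
Qed.

(** The kernel [e ^ (- i xi x)] gives real part [fcos] and imaginary part [- fsin]; the sign
    disappears in the square. *)
Lemma normc_fourier w xi : continuous w -> (forall x, ~ -1 <= x <= 1 -> w x = 0) ->
  ComplexField.Normc.normc (fourier w xi) ^+ 2 = spectrum w xi.
Proof.
move=> cw w0; rewrite /fourier /Cintegral /=.
rewrite sqr_sqrtr ?addr_ge0 ?sqr_ge0//.
have -> : \int[mu]_x complex.Re ((w x)%:C%C * expi (- (xi * x))) = fcos w xi.
  under eq_Rintegral do rewrite /= mul0r subr0 cosN.
  by rewrite Rintegral_support// => x /w0 ->; rewrite mul0r.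
have -> : \int[mu]_x complex.Im ((w x)%:C%C * expi (- (xi * x))) = - fsin w xi.
  rewrite -fsinN// /fsin.
  under eq_Rintegral do rewrite /= mul0r addr0 -mulNr.
  by rewrite Rintegral_support// => x /w0 ->; rewrite mul0r.
by rewrite sqrrN.
Qed.

End FourierOfExtension.

Theorem lemma3 (R : realType) (alpha : R) (halpha : 0 < alpha) :
  exists2 C : R, 0 < C &
    forall (N : nat) (u : R -> R), (1 <= N)%N -> FN alpha N u ->
      (energy_seminorm alpha u ^+ 2
         <= (C * N%:R `^ (4 * alpha))%:E * L2norm u ^+ 2)%E.
Proof.
have [C C0 HC] := wpoly_energy_bound halpha.
have pi0 := @pi_gt0 R.
(* The factor [1 / (2 pi)] is the normalisation in the energy seminorm. *)
exists ((2 * pi)^-1 * C); first by rewrite mulr_gt0// invr_gt0 mulr_gt0.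
move=> N u N0 [p sp uE]; have ext0E := ext0_wpoly halpha uE.
set w := wpoly alpha p in ext0E; have cw : continuous w by exact: continuous_wpoly.
have w0 x : ~ -1 <= x <= 1 -> w x = 0.
  by move=> x1; apply: wpoly_out => // /andP[x2 x3]; apply: x1; rewrite !ltW.
(* The squared norm over the line becomes a finite integral over [-1, 1], because [w] vanishes
   outside and is continuous. *)
have L2E : (L2norm u ^+ 2 = (\int[lebesgue_measure]_(x in `[(-1)%R, 1%R]) w x ^+ 2)%:E)%E.
  rewrite /L2norm ext0E unlock poweR12_sqrt; last first.
    by apply: integral_ge0 => x _; rewrite lee_fin powR_ge0.
  rewrite sqr_sqrte; last by apply: integral_ge0 => x _; rewrite lee_fin powR_ge0.
  have cw2 : continuous (fun x => w x ^+ 2) := continuousMf cw cw.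
  rewrite -(EFin_Rintegral_itvcc _ _ cw2) [RHS]integral_mkcond; apply: eq_integral => x _.
  rewrite patchE; case: ifPn => [_|].
    by rewrite /= powR_mulrn ?normr_ge0// real_normK ?num_real.
  move=> /negP; rewrite inE/= in_itv/= => /w0 wx; rewrite /= wx.
  by rewrite normr0 powR0 ?pnatr_eq0.
have q0 : 0 <= (2 * pi)^-1 :> R by rewrite invr_ge0 mulr_ge0// ltW.
rewrite L2E /energy_seminorm ext0E poweR12_sqrt; last first.
  rewrite mule_ge0 ?lee_fin// integral_ge0// => xi _.
  by rewrite lee_fin mulr_ge0 ?powR_ge0 ?sqr_ge0.
rewrite sqr_sqrte; last first.
  rewrite mule_ge0 ?lee_fin// integral_ge0// => xi _.
  by rewrite lee_fin mulr_ge0 ?powR_ge0 ?sqr_ge0.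
under eq_integral do rewrite normc_fourier//.
apply: le_trans (lee_wpmul2l _ (HC N p N0 sp)) _; first by rewrite lee_fin.
by rewrite -!EFinM lee_fin !mulrA.
Qed.
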